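(* Let $\rho>0$ and let $w_\rho\in W$, $w^\nu_\rho=(x^\nu_\rho,\hat y^\nu_\rho)$, be a variational equilibrium of the $\rho$-penalized NEP, i.e., $$0\in\nabla_{w^\nu}\theta^\nu(w^\nu_\rho,x^{-\nu}_\rho)+\rho\nabla_{w^\nu}h_\mu(w^\nu_\rho,x^{-\nu}_\rho)+\mathcal{N}_{W^\nu}(w^\nu_\rho)$$ for all $\nu\in\{1,\dots,N\}$. Then $w_\rho$ is a variational equilibrium of the $\delta$-relaxed GNEP with $\delta^\nu=h_\mu(w^\nu_\rho,x^{-\nu}_\rho)$ for all $\nu$.
   Context: Setting (multi-leader--follower game). There are $N$ leaders and $M$ followers. Leader $\nu\in\{1,\dots,N\}$ chooses $x^\nu\in X^\nu\subset\mathbb{R}^{n_\nu}$; follower $\omega\in\{1,\dots,M\}$ chooses $y^\omega\in Y^\omega\subset\mathbb{R}^{m_\omega}$. Put $n=\sum_\nu n_\nu$, $m=\sum_\omega m_\omega$, $X=\prod_\nu X^\nu$, $Y=\prod_\omega Y^\omega$ (all nonempty). Cost functions are $\theta^\nu:\mathbb{R}^{n+m}\to\mathbb{R}$ (leaders, a function of $(x,y)$) and $\gamma^\omega:\mathbb{R}^{n+m}\to\mathbb{R}$ (followers, a function of $(x,y)$). Write $x=(x^\nu,x^{-\nu})$ and $y=(y^\omega,y^{-\omega})$, where $x^{-\nu}$ (resp. $y^{-\omega}$) collects the strategies of the other players. Standing assumptions. Every $X^\nu$ and every $Y^\omega$ is convex and compact; every $\theta^\nu$ and every $\gamma^\omega$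 is twice continuously differentiable on an open bounded set containing $X\times Y$. $\ell>0$ is a constant such that every $\gamma^\omega$ is $\ell$-smooth on $X\times Y$ (its gradient is $\ell$-Lipschitz there), and $0<\mu<\ell^{-1}$. Regularized value-function: $$h_\mu(x,y)=\max_{z\in Y}\Big\{\sum_{\omega=1}^M[\gamma^\omega(x,y^\omega,y^{-\omega})-\gamma^\omega(x,z^\omega,y^{-\omega})]-\frac1{2\mu}\|y-z\|^2\Big\},$$ which is continuously differentiable under these assumptions. Leader $\nu$'s extended variable is $w^\nu=(x^\nu,\hat y^\nu)\in W^\nu:=X^\nu\times Y$, where $\hat y^\nu\in\mathbb{R}^m$ is leader $\nu$'s own copy of the followers' strategy tuple; $W=\prod_\nu W^\nu$. Write $\theta^\nu(w^\nu,x^{-\nu})=\theta^\nu(x^\nu,x^{-\nu},\hat y^\nu)$ and $h_\mu(w^\nu,x^{-\nu})=h_\mu((x^\nu,x^{-\nu}),\hat y^\nu)$; $\nabla_{w^\nu}$ is the partial gradient in $w^\nu$. $\mathcal{N}_\Sigma(u)=\{s\mid\langle s,v-u\rangle\le0\ \forall v\in\Sigma\}$ is the normal cone to a convex set $\Sigma$ at $u\in\Sigma$. $\rho$-penalized NEP: the game in which leader $\nu$ minimizes $\theta^\nu(w^\nu,x^{-\nu})+\rho h_\mu(w^\nu,x^{-\nu})$ over $w^\nu\in W^\nu$. $\delta$-relaxed GNEP, for $\delta=(\delta^1,\dots,\delta^N)$ with $\delta^\nu\ge0$: the game in which leader $\nu$ minimizes $\theta^\nu(w^\nu,x^{-\nu})$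 over $w^\nu\in\hat W^\nu_{\delta^\nu}(x^{-\nu})=\{w^\nu\in W^\nu\mid h_\mu(w^\nu,x^{-\nu})\le\delta^\nu\}$. A point $w_\delta$ is a variational equilibrium of the $\delta$-relaxed GNEP if for every $\nu$ one has $w^\nu_\delta\in\hat W^\nu_{\delta^\nu}(x^{-\nu}_\delta)$ and there exists $\zeta^\nu_\delta\ge0$ with $$0\in\nabla_{w^\nu}\theta^\nu(w^\nu_\delta,x^{-\nu}_\delta)+\zeta^\nu_\delta\nabla_{w^\nu}h_\mu(w^\nu_\delta,x^{-\nu}_\delta)+\mathcal{N}_{W^\nu}(w^\nu_\delta),$$ $$h_\mu(w^\nu_\delta,x^{-\nu}_\delta)-\delta^\nu\le0,\qquad \zeta^\nu_\delta\,\big(h_\mu(w^\nu_\delta,x^{-\nu}_\delta)-\delta^\nu\big)=0.$$ *)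

(* Defs.v *)
From HB Require Import structures.
From mathcomp Require Export all_boot all_order all_algebra.
From mathcomp Require Export all_classical all_reals all_analysis.

Set Implicit Arguments.
Unset Strict Implicit.
Unset Printing Implicit Defensive.

Export Order.TTheory GRing.Theory Num.Theory.
Export numFieldNormedType.Exports.

#[export] Set Implicit Arguments.
#[export] Unset Strict Implicit.
#[export] Unset Printing Implicit Defensive.

Local Open Scope classical_set_scope.
Local Open Scope ring_scope.

(* The norm that MathComp-Analysis puts on 'rV[R]_k is the sup norm; it is used
   below only through the (norm-independent) topology and differentiability.
   The metric notions are the Euclidean ones. *)
Definition dotp (R : realType) (k : nat) (u v : 'rV[R]_k) : R :=
  \sum_(i < k) u 0 i * v 0 i.

Definition enorm (R : realType) (k : nat) (u : 'rV[R]_k) : R :=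
  Num.sqrt (dotp u u).

Definition gradient (R : realType) (k : nat) (f : 'rV[R]_k -> R)
    (p : 'rV[R]_k) : 'rV[R]_k :=
  \row_(i < k) 'D_(delta_mx 0 i) f p.

Definition C1_on (R : realType) (k : nat) (U : set 'rV[R]_k)
    (f : 'rV[R]_k -> R) : Prop :=
  forall p, U p -> differentiable f p /\ {for p, continuous (gradient f)}.

Definition C2_on (R : realType) (k : nat) (U : set 'rV[R]_k)
    (f : 'rV[R]_k -> R) : Prop :=
  C1_on U f /\ forall i : 'I_k, C1_on U (fun p => gradient f p 0 i).

Definition smooth_on (R : realType) (k : nat) (l : R) (A : set 'rV[R]_k)
    (f : 'rV[R]_k -> R) : Prop :=
  forall p q, A p -> A q ->
    enorm (gradient f p - gradient f q) <= l * enorm (p - q).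

(* To be used at points u of S. *)
Definition normal_cone (R : realType) (k : nat) (S : set 'rV[R]_k)
    (u : 'rV[R]_k) : set 'rV[R]_k :=
  [set s | forall v, S v -> dotp s (v - u) <= 0].

(* R^(a + b) is identified with R^a * R^b through lsubmx, rsubmx and row_mx;
   R^(\sum_i d i) with the product of the R^(d i) through submxrow and
   \mxrow. *)
Definition pair_set (R : realType) (a b : nat) (A : set 'rV[R]_a)
    (B : set 'rV[R]_b) : set 'rV[R]_(a + b) :=
  [set p | A (lsubmx p) /\ B (rsubmx p)].

Definition block_set (R : realType) (K : nat) (d : 'I_K -> nat)
    (S : forall i : 'I_K, set 'rV[R]_(d i)) : set 'rV[R]_(\sum_(i < K) d i) :=
  [set x | forall i, S i (submxrow x i)].

(* The tuple (v, x^{-i}): the i-th block of x is replaced by v. *)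
Definition set_block (R : realType) (K : nat) (d : 'I_K -> nat)
    (x : 'rV[R]_(\sum_(i < K) d i)) (i : 'I_K) (v : 'rV[R]_(d i)) :
    'rV[R]_(\sum_(i < K) d i) :=
  \mxrow_(j < K) @dfwith _ (fun j => 'rV[R]_(d j)) (submxrow x) i v j.

Section Game.
Variables (R : realType) (N M : nat) (nn : 'I_N -> nat) (mm : 'I_M -> nat).
Local Notation n := (\sum_(nu < N) nn nu)%N.
Local Notation m := (\sum_(om < M) mm om)%N.

(* The supremum is total. When Y is compact and nonempty and the gamma om are
   continuous on a neighborhood of X * Y, it is a maximum for all (x, y) in some
   (possibly smaller) neighborhood of X * Y, so that the derivatives of h_mu at
   points of X * Y, boundary points included, are those of the maximum. *)
Definition h_mu (gamma : 'I_M -> 'rV[R]_(n + m) -> R)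
    (Y : forall om : 'I_M, set 'rV[R]_(mm om)) (mu : R)
    (p : 'rV[R]_(n + m)) : R :=
  let x := lsubmx p in
  let y := rsubmx p in
  sup [set \sum_(om < M) (gamma om (row_mx x y)
                          - gamma om (row_mx x (set_block y (submxrow z om))))
           - (2 * mu)^-1 * enorm (y - z) ^+ 2 | z in block_set Y].

Definition Wset (X : forall nu : 'I_N, set 'rV[R]_(nn nu))
    (Y : forall om : 'I_M, set 'rV[R]_(mm om)) (nu : 'I_N) :
    set 'rV[R]_(nn nu + m) :=
  pair_set (X nu) (block_set Y).

Definition leaders (w : forall nu : 'I_N, 'rV[R]_(nn nu + m)) : 'rV[R]_n :=
  \mxrow_(nu < N) lsubmx (w nu).

(* f(u, x^{-nu}) for u = (x^nu, yhat^nu); the nu-th block of x is irrelevant. *)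
Definition own (f : 'rV[R]_(n + m) -> R) (x : 'rV[R]_n) (nu : 'I_N)
    (u : 'rV[R]_(nn nu + m)) : R :=
  f (row_mx (set_block x (lsubmx u)) (rsubmx u)).

Definition own_val (f : 'rV[R]_(n + m) -> R)
    (w : forall nu : 'I_N, 'rV[R]_(nn nu + m)) (nu : 'I_N) : R :=
  own f (leaders w) (w nu).

Definition own_grad (f : 'rV[R]_(n + m) -> R)
    (w : forall nu : 'I_N, 'rV[R]_(nn nu + m)) (nu : 'I_N) :
    'rV[R]_(nn nu + m) :=
  gradient (own f (leaders w) (nu := nu)) (w nu).

Definition penalized_VE (X : forall nu : 'I_N, set 'rV[R]_(nn nu))
    (Y : forall om : 'I_M, set 'rV[R]_(mm om))
    (theta : 'I_N -> 'rV[R]_(n + m) -> R)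
    (gamma : 'I_M -> 'rV[R]_(n + m) -> R) (mu rho : R)
    (w : forall nu : 'I_N, 'rV[R]_(nn nu + m)) : Prop :=
  forall nu : 'I_N,
    Wset X Y (w nu) /\
    [set own_grad (theta nu) w nu + rho *: own_grad (h_mu gamma Y mu) w nu + s
       | s in normal_cone (Wset X Y (nu := nu)) (w nu)] 0.

Definition relaxed_set (X : forall nu : 'I_N, set 'rV[R]_(nn nu))
    (Y : forall om : 'I_M, set 'rV[R]_(mm om))
    (gamma : 'I_M -> 'rV[R]_(n + m) -> R) (mu : R) (delta : 'I_N -> R)
    (x : 'rV[R]_n) (nu : 'I_N) : set 'rV[R]_(nn nu + m) :=
  [set u | Wset X Y u /\ own (h_mu gamma Y mu) x u <= delta nu].

Definition relaxed_VE (X : forall nu : 'I_N, set 'rV[R]_(nn nu))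
    (Y : forall om : 'I_M, set 'rV[R]_(mm om))
    (theta : 'I_N -> 'rV[R]_(n + m) -> R)
    (gamma : 'I_M -> 'rV[R]_(n + m) -> R) (mu : R) (delta : 'I_N -> R)
    (w : forall nu : 'I_N, 'rV[R]_(nn nu + m)) : Prop :=
  forall nu : 'I_N,
    relaxed_set X Y gamma mu delta (leaders w) (w nu) /\
    exists zeta : R,
      [/\ 0 <= zeta,
          [set own_grad (theta nu) w nu
               + zeta *: own_grad (h_mu gamma Y mu) w nu + s
             | s in normal_cone (Wset X Y (nu := nu)) (w nu)] 0,
          own_val (h_mu gamma Y mu) w nu - delta nu <= 0 &
          zeta * (own_val (h_mu gamma Y mu) w nu - delta nu) = 0].

End Game.

(* Main.v *)
Require Import Defs.
From mathcomp Require Import all_boot all_order all_algebra.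
From mathcomp Require Import all_classical all_reals all_analysis.
Local Open Scope classical_set_scope.
Local Open Scope ring_scope.

(** The multiplier of the relaxed game is the penalty parameter itself. With
    zeta = rho the two stationarity inclusions coincide, and relaxing each
    leader's constraint h_mu <= 0 exactly up to the value attained at w makes
    that constraint active, so that complementarity holds whatever the sign of
    zeta. It remains to see that these relaxation levels are nonnegative: by
    [h_mu_ge0], h_mu (x, y) >= 0 as soon as y belongs to Y, because the choice
    z = y in the maximum defining h_mu contributes the value 0. *)

Set Implicit Arguments.
Unset Strict Implicit.
Unset Printing Implicit Defensive.

Lemma enorm0 (R : realType) (k : nat) : enorm (0 : 'rV[R]_k) = 0.
Proof.
by rewrite /enorm /dotp big1 ?sqrtr0// => i _; rewrite mxE mul0r.
Qed.

Lemma set_block_id (R : realType) (K : nat) (d : 'I_K -> nat)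
    (x : 'rV[R]_(\sum_(i < K) d i)) (i : 'I_K) :
  set_block x (submxrow x i) = x.
Proof.
rewrite /set_block -[RHS]submxrowK; apply: eq_mxrow => j.
by case: dfwithP.
Qed.

(** If [A] is unbounded above, [sup A] takes its default value, which is 0. *)
Lemma sup_ge0_mem0 (R : realType) (A : set R) : A 0 -> 0 <= sup A.
Proof.
move=> A0; have [supA|/sup_out->//] := pselect (has_sup A).
exact: (ub_le_sup supA.2).
Qed.

(** At z = y no follower deviates and the proximal term vanishes, so 0 is one
    of the values over which the supremum is taken. *)
Lemma h_mu_ge0 (R : realType) (N M : nat) (nn : 'I_N -> nat)
    (mm : 'I_M -> nat)
    (gamma : 'I_M -> 'rV[R]_(\sum_(nu < N) nn nu + \sum_(om < M) mm om) -> R)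
    (Y : forall om : 'I_M, set 'rV[R]_(mm om)) (mu : R)
    (p : 'rV[R]_(\sum_(nu < N) nn nu + \sum_(om < M) mm om)) :
  block_set Y (rsubmx p) -> 0 <= h_mu gamma Y mu p.
Proof.
move=> Yp; apply: sup_ge0_mem0; exists (rsubmx p) => //.
rewrite subrr enorm0 expr0n mulr0 subr0 big1// => om _.
by rewrite set_block_id subrr.
Qed.

Theorem theorem4p3 (R : realType) (N M : nat)
  (nn : 'I_N -> nat) (mm : 'I_M -> nat)
  (X : forall nu : 'I_N, set 'rV[R]_(nn nu))
  (Y : forall om : 'I_M, set 'rV[R]_(mm om))
  (theta : 'I_N -> 'rV[R]_(\sum_(nu < N) nn nu + \sum_(om < M) mm om) -> R)
  (gamma : 'I_M -> 'rV[R]_(\sum_(nu < N) nn nu + \sum_(om < M) mm om) -> R)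
  (U : set 'rV[R]_(\sum_(nu < N) nn nu + \sum_(om < M) mm om))
  (l mu rho : R)
  (w : forall nu : 'I_N, 'rV[R]_(nn nu + \sum_(om < M) mm om)) :
  (forall nu, X nu !=set0) -> (forall om, Y om !=set0) ->
  (forall nu, convex_set (X nu)) -> (forall om, convex_set (Y om)) ->
  (forall nu, compact (X nu)) -> (forall om, compact (Y om)) ->
  open U -> bounded_set U -> pair_set (block_set X) (block_set Y) `<=` U ->
  (forall nu, C2_on U (theta nu)) -> (forall om, C2_on U (gamma om)) ->
  0 < l ->
  (forall om, smooth_on l (pair_set (block_set X) (block_set Y)) (gamma om)) ->
  0 < mu -> mu < l^-1 ->
  0 < rho ->
  penalized_VE X Y theta gamma mu rho w ->
  let delta := fun nu => own_val (h_mu gamma Y mu) w nu in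
  (forall nu, 0 <= delta nu) /\ relaxed_VE X Y theta gamma mu delta w.
Proof.
move=> _ _ _ _ _ _ _ _ _ _ _ _ _ _ _ rho_gt0 VEw delta; split=> nu.
  have [[_ Yw] _] := VEw nu.
  by apply: h_mu_ge0; rewrite row_mxKr.
have [Ww statw] := VEw nu.
split; first by split=> //; exact: lexx.
by exists rho; split; rewrite ?subrr ?mulr0// ltW.
Qed.
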